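(* Let $X$ be a closed convex subset of a finite-dimensional vector space, let $g:X\to\mathbb{R}^n$ be a $\mu$-relatively strongly monotone operator with $\mu>0$, and let $z_*$ be the exact solution of the Minty variational inequality for $g$ on $X$. Let $\delta>0$ and let $(z_k)$, $(L_k)$ be generated by the adaptive first-order method described in the context. Then for every $k\geqslant0$, $$V(z_*,z_{k+1})\leqslant\prod_{i=1}^{k+1}\left(1+\frac{\mu}{L_i}\right)^{-1}V(z_*,z_0)+\frac{\delta}{L_{k+1}+\mu}+\sum_{j=1}^{k}\frac{\delta}{L_j+\mu}\prod_{i=j+1}^{k+1}\left(1+\frac{\mu}{L_i}\right)^{-1}.$$
   Context: $d$ is a prox-function: continuously differentiable and convex on the ambient finite-dimensional space. $V(y,x)=d(y)-d(x)-\langle\nabla d(x),y-x\rangle$ is its Bregman divergence. Minty variational inequality: find $z_*\in X$ with $\langle g(x),z_*-x\rangle\leqslant0$ for all $x\in X$. $g$ is $\mu$-relatively strongly monotone if $\mu V(y,x)+\mu V(x,y)\leqslant\langle g(y)-g(x),y-x\rangle$ for all $x,y\in X$. Adaptive first-order method. Input: $\delta>0$, $L_0>0$, $\mu>0$, $d$, $V$. Set $z_0=\arg\min_{u\in X}d(u)$. For $k=0,1,2,\dots$: find the smallest integer $i_k\geqslant0$ such that, with $L_{k+1}=2^{i_k-1}L_k$, $$w_k=\arg\min_{y\in X}\left\{\left\langle\tfrac{1}{L_{k+1}}g(z_k),y\right\rangle+V(y,z_k)\right\},$$ $$z_{k+1}=\arg\min_{z\in X}\left\{\left\langle\tfrac{1}{L_{k+1}}g(w_k),z\right\rangle+V(z,z_k)+\tfrac{\mu}{L_{k+1}}V(z,w_k)\right\},$$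 one has $$\langle g(z_k)-g(w_k),z_{k+1}-w_k\rangle\leqslant L_{k+1}\big(V(w_k,z_k)+V(z_{k+1},w_k)\big)+\delta.$$ *)

(* Defs.v *)
From mathcomp Require Import all_boot all_order all_algebra.
From mathcomp Require Import all_classical all_reals all_analysis.
Set Implicit Arguments.
Unset Strict Implicit.
Unset Printing Implicit Defensive.
Import Order.TTheory GRing.Theory Num.Theory.
Import numFieldNormedType.Exports.
Local Open Scope classical_set_scope.
Local Open Scope ring_scope.

Definition inner (R : realType) (n : nat) (u v : 'rV[R]_n) : R :=
  \sum_(i < n) u 0 i * v 0 i.

Definition gradient (R : realType) (n : nat) (d : 'rV[R]_n -> R)
    (x : 'rV[R]_n) : 'rV[R]_n :=
  \row_(i < n) 'D_(delta_mx 0 i) d x.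

Definition continuously_differentiable (R : realType) (n : nat)
    (d : 'rV[R]_n -> R) : Prop :=
  (forall x, differentiable d x) /\ continuous (gradient d).

Definition prox_function (R : realType) (n : nat) (d : 'rV[R]_n -> R) : Prop :=
  continuously_differentiable d /\
  convex_function [set: convex_lmodType 'rV[R]_n] d.

Definition bregman (R : realType) (n : nat) (d : 'rV[R]_n -> R)
    (y x : 'rV[R]_n) : R :=
  d y - d x - inner (gradient d x) (y - x).

(* The operator g : X -> R^n is represented by a total function; every
   definition below evaluates it at points of X only. *)
Definition rel_strongly_monotone (R : realType) (n : nat) (X : set 'rV[R]_n)
    (d : 'rV[R]_n -> R) (mu : R) (g : 'rV[R]_n -> 'rV[R]_n) : Prop :=
  forall x y, X x -> X y ->
    mu * bregman d y x + mu * bregman d x y <= inner (g y - g x) (y - x).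

Definition minty_solution (R : realType) (n : nat) (X : set 'rV[R]_n)
    (g : 'rV[R]_n -> 'rV[R]_n) (zstar : 'rV[R]_n) : Prop :=
  X zstar /\ forall x, X x -> inner (g x) (zstar - x) <= 0.

(* A prox-function need not be strictly convex, so minimizers need not be
   unique: argmin is a relation, and "x = argmin f" means that x is one of the
   minimizers. *)
Definition is_argmin (R : realType) (n : nat) (X : set 'rV[R]_n)
    (f : 'rV[R]_n -> R) (x : 'rV[R]_n) : Prop :=
  X x /\ forall y, X y -> f x <= f y.

Definition trial_step (R : realType) (n : nat) (X : set 'rV[R]_n)
    (d : 'rV[R]_n -> R) (g : 'rV[R]_n -> 'rV[R]_n) (mu l : R)
    (zk w z : 'rV[R]_n) : Prop :=
  is_argmin X (fun y => inner (l^-1 *: g zk) y + bregman d y zk) w /\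
  is_argmin X (fun u => inner (l^-1 *: g w) u + bregman d u zk
                        + mu / l * bregman d u w) z.

Definition acceptable (R : realType) (n : nat)
    (d : 'rV[R]_n -> R) (g : 'rV[R]_n -> 'rV[R]_n) (delta l : R)
    (zk w z : 'rV[R]_n) : Prop :=
  inner (g zk - g w) (z - w) <= l * (bregman d w zk + bregman d z w) + delta.

Definition trial_constant (R : realType) (Lk : R) (i : nat) : R :=
  2 ^ (i%:Z - 1) * Lk.

(* In run_smallest every smaller exponent was tried with some choice of
   minimizers and rejected; when minimizers are unique this says exactly that
   i k is the smallest exponent passing the acceptance test. *)
Record adaptive_run (R : realType) (n : nat) (X : set 'rV[R]_n)
    (d : 'rV[R]_n -> R) (g : 'rV[R]_n -> 'rV[R]_n) (mu delta : R)
    (i : nat -> nat) (L : nat -> R) (w z : nat -> 'rV[R]_n) : Prop := {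
  run_init : is_argmin X d (z 0%N);
  run_constant : forall k, L k.+1 = trial_constant (L k) (i k);
  run_step : forall k, trial_step X d g mu (L k.+1) (z k) (w k) (z k.+1);
  run_accept : forall k, acceptable d g delta (L k.+1) (z k) (w k) (z k.+1);
  run_smallest : forall k j, (j < i k)%N ->
    exists w' z', trial_step X d g mu (trial_constant (L k) j) (z k) w' z' /\
      ~ acceptable d g delta (trial_constant (L k) j) (z k) w' z'
}.

(* Main.v *)
(* Adding the optimality conditions of the two prox steps (tested at z_{k+1} and
   at z_* ) to the acceptance test gives
     <g(w_k), w_k - z_*> <= L V(z_*, z_k) - (L + mu) V(z_*, z_{k+1})
                            + mu V(z_*, w_k) - mu V(z_{k+1}, w_k) + delta
   with L = L_{k+1}. Strong monotonicity improves the Minty inequality to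
   mu V(z_*, x) <= <g(x), x - z_*>, which absorbs the term mu V(z_*, w_k), so
   V(z_*, z_{k+1}) <= (1 + mu / L)^-1 V(z_*, z_k) + delta / (L + mu); unrolling
   this affine recursion gives the bound. *)
Require Import Defs.
From mathcomp Require Import all_boot all_order all_algebra.
From mathcomp Require Import all_classical all_reals all_analysis.
From mathcomp Require Import ring lra.
Import Order.TTheory GRing.Theory Num.Theory.
Import numFieldNormedType.Exports.
Local Open Scope classical_set_scope.
Local Open Scope ring_scope.

Section Inner.
Context {R : realType} {n : nat}.
Implicit Types (u v w : 'rV[R]_n) (a : R).

Lemma innerDl u v w : inner (u + v) w = inner u w + inner v w.
Proof. by rewrite -big_split; apply: eq_bigr => i _; rewrite mxE mulrDl. Qed.

Lemma innerDr u v w : inner u (v + w) = inner u v + inner u w.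
Proof. by rewrite -big_split; apply: eq_bigr => i _; rewrite mxE mulrDr. Qed.

Lemma innerZl a u v : inner (a *: u) v = a * inner u v.
Proof. by rewrite mulr_sumr; apply: eq_bigr => i _; rewrite mxE mulrA. Qed.

Lemma innerZr a u v : inner u (a *: v) = a * inner u v.
Proof. by rewrite mulr_sumr; apply: eq_bigr => i _; rewrite mxE mulrCA. Qed.

Lemma innerNl u v : inner (- u) v = - inner u v.
Proof. by rewrite -scaleN1r innerZl mulN1r. Qed.

Lemma innerNr u v : inner u (- v) = - inner u v.
Proof. by rewrite -scaleN1r innerZr mulN1r. Qed.

Definition innerE := (innerDl, innerDr, innerNl, innerNr, innerZl, innerZr).

End Inner.

Section Bregman.
Set Implicit Arguments.
Unset Strict Implicit.
Context {R : realType} {n : nat}.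
Implicit Types (X : set 'rV[R]_n) (d : 'rV[R]_n -> R) (x y p u : 'rV[R]_n).

(** Differentiability makes the directional derivative linear in [u], hence determined by the
    partial derivatives stored in [gradient]. *)
Lemma inner_gradient d x u :
  differentiable d x -> inner (gradient d x) u = 'D_u d x.
Proof.
move=> dx; rewrite deriveE// [in RHS](row_sum_delta u) linear_sum.
by apply: eq_bigr => i _; rewrite linearZ mxE deriveE// mulrC.
Qed.

(** Divide by [t] and let [t] tend to 0 from the right. This serves as the first-order optimality
    condition for an affine function plus [c] times [d], with [t * a] the affine increment. *)
Lemma directional_ge0 d x u (a c : R) : differentiable d x ->
  (forall t, 0 < t -> t < 1 -> 0 <= t * a + c * (d (x + t *: u) - d x)) ->
  0 <= a + c * inner (gradient d x) u.
Proof.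
move=> dx ge0; rewrite inner_gradient//.
have /cvg_ex[l dl] := diff_derivable dx (v := u).
have -> : 'D_u d x = l by exact: cvg_lim.
have lim_l : a + c * (t^-1 * (d (t *: u + x) - d x)) @[t --> 0^'+] --> a + c * l.
  by apply: cvgD; [exact: cvg_cst|apply: cvgMl_tmp; exact: cvg_dnbhs_at_right dl].
apply: (cvgr_to_ge lim_l).
near=> t.
have t0 : 0 < t by near: t; exact: nbhs_right_gt.
have t1 : t < 1 by near: t; exact: nbhs_right_lt.
rewrite -(pmulr_rge0 _ t0) [t *: u + x]addrC mulrDr mulrCA mulVKf ?gt_eqF//.
exact: ge0.
Unshelve. all: by end_near. Qed.

Lemma conv_segment x y (p : {i01 R}) :
  conv p (y : convex_lmodType _) x = x + p%:num *: (y - x).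
Proof.
rewrite -[LHS]/(p%:num *: y + (1 - p%:num) *: x).
by rewrite scalerBl scale1r scalerBr addrCA.
Qed.

Lemma convex_set_segment X x y (t : R) : @convex_set R 'rV[R]_n X ->
  0 < t -> t < 1 -> X x -> X y -> X (x + t *: (y - x)).
Proof.
move=> cX t0 t1 Xx Xy.
have := cX y x (Itv01 (ltW t0) (ltW t1)).
by rewrite !inE conv_segment; apply.
Qed.

Lemma bregman_ge0 d y x : prox_function d -> 0 <= bregman d y x.
Proof.
move=> [[diffd _] cvxd]; rewrite /bregman -[- inner _ _]mulN1r.
(* Here [a] is [d y - d x] and [c] is -1; the hypothesis is convexity on the segment from [x] to
   [y]. *)
apply: directional_ge0 => [//|t t0 t1].
have : d (x + t *: (y - x)) <= t * d y + (1 - t) * d x.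
  by have := cvxd (Itv01 (ltW t0) (ltW t1)) y x; rewrite !inE conv_segment; apply.
by lra.
Qed.

(** The objective is [(1 + c) * d] plus an affine function, so optimality at [p] in the direction
    [u - p] is a gradient inequality. The identity V(u,x) - V(u,p) - V(p,x) = <∇d(p) - ∇d(x), u -
    p>, used for [x] and for [y], turns it into the bound. *)
Lemma bregman_prox_le X d (a x y p u : 'rV[R]_n) (c : R) :
  @convex_set R 'rV[R]_n X -> differentiable d p ->
  is_argmin X (fun v => inner a v + bregman d v x + c * bregman d v y) p ->
  X u ->
  inner a (p - u) <= bregman d u x - bregman d u p - bregman d p x
    + c * (bregman d u y - bregman d u p - bregman d p y).
Proof.
move=> cX dp [Xp minp] Xu.
have := @directional_ge0 d p (u - p)
  (inner (a - gradient d x - c *: gradient d y) (u - p)) (1 + c) dp.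
have ge0 (t : R) : 0 < t -> t < 1 ->
    0 <= t * inner (a - gradient d x - c *: gradient d y) (u - p)
       + (1 + c) * (d (p + t *: (u - p)) - d p).
  move=> t0 t1; have := minp _ (convex_set_segment cX t0 t1 Xp Xu).
  by rewrite /bregman !innerE; lra.
by move=> /(_ ge0); rewrite /bregman !innerE; lra.
Qed.

(* Without continuity of [g], Minty gives no sign to [inner (g zstar) (x - zstar)],
   so monotonicity is not applied at [zstar] but at [zstar + t (x - zstar)], and
   [t] tends to [0]. *)
Lemma minty_strong X d (mu : R) g zstar x :
  @convex_set R 'rV[R]_n X -> prox_function d -> 0 < mu ->
  rel_strongly_monotone X d mu g -> minty_solution X g zstar -> X x ->
  mu * bregman d zstar x <= inner (g x) (x - zstar).
Proof.
move=> cX pd mu0 hg [Xz hz] Xx.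
set A := inner (g x) (x - zstar) - mu * bregman d zstar x.
set B := inner (g x) (x - zstar)
         + mu * inner (gradient d zstar - gradient d x) (x - zstar).
(* V(x,y) >= 0 is dropped, and V(y,zstar) >= 0 bounds [d y] below by the linearization of [d] at
   [zstar]; the resulting error is linear in [t], with coefficient [B]. *)
have AB (t : R) : 0 < t -> t < 1 -> t * B <= A.
  move=> t0 t1; set y := zstar + t *: (x - zstar).
  have Xy : X y by exact: convex_set_segment.
  have yz : 0 <= inner (g y) (x - zstar).
    have := hz y Xy; rewrite /y opprD addrA subrr sub0r innerNr innerZr.
    by rewrite oppr_le0 pmulr_rge0.
  have xy : x - y = (1 - t) *: (x - zstar).
    by rewrite /y opprD addrA scalerBl scale1r.
  have := hg y x Xy Xx; rewrite xy innerZr innerDl innerNl.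
  have : 0 <= mu * bregman d x y by rewrite mulr_ge0 ?bregman_ge0 // ltW.
  have : 0 <= mu * bregman d y zstar by rewrite mulr_ge0 ?bregman_ge0 // ltW.
  have : 0 <= (1 - t) * inner (g y) (x - zstar) by rewrite mulr_ge0 ?subr_ge0 // ltW.
  rewrite /A /B /bregman {2 4}/y !innerE; lra.
rewrite -subr_ge0 -/A.
have lim_A : A - t * B @[t --> 0^'+] --> A - 0 * B.
  apply: cvgB; first exact: cvg_cst.
  by apply: cvgMr_tmp; apply: cvg_at_right_filter; exact: cvg_id.
rewrite mul0r subr0 in lim_A.
apply: (cvgr_to_ge lim_A); near=> t; rewrite subr_ge0.
by apply: AB; near: t; [exact: nbhs_right_gt|exact: nbhs_right_lt].
Unshelve. all: by end_near. Qed.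

Lemma adaptive_step X d g (mu delta l : R) zstar zk w z :
  @convex_set R 'rV[R]_n X -> prox_function d -> 0 < mu -> 0 < l ->
  rel_strongly_monotone X d mu g -> minty_solution X g zstar ->
  trial_step X d g mu l zk w z -> acceptable d g delta l zk w z ->
  bregman d zstar z <=
    (1 + mu / l)^-1 * bregman d zstar zk + delta / (l + mu).
Proof.
move=> cX pd mu0 l0 hg hz [argw argz] acc.
have [[diffd _] _] := pd.
have [Xw _] := argw; have [Xz _] := argz; have [Xstar _] := hz.
have := minty_strong cX pd mu0 hg hz Xw.
(* A second Bregman term of weight 0 puts the first prox step in the form of [bregman_prox_le]. *)
have argw0 : is_argmin X (fun v => inner (l^-1 *: g zk) v + bregman d v zk
                                   + 0 * bregman d v zk) w.
  by split=> // v Xv; rewrite !mul0r !addr0; exact: argw.2.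
have := bregman_prox_le cX (diffd w) argw0 Xz.
have := bregman_prox_le cX (diffd z) argz Xstar.
rewrite mul0r addr0 !innerZl !(ler_pdivrMl _ _ l0).
rewrite mulrDr mulrA (mulrCA l) divff ?gt_eqF // mulr1.
move: acc; rewrite /acceptable.
(* This allows the leftover term - mu V(z,w) to be discarded. *)
have : 0 <= mu * bregman d z w by rewrite mulr_ge0 ?bregman_ge0 // ltW.
rewrite !innerE => H0 H1 H2 H3 H4.
have lmu : 0 < l + mu by rewrite addr_gt0.
have -> : (1 + mu / l)^-1 * bregman d zstar zk + delta / (l + mu) =
    (l * bregman d zstar zk + delta) / (l + mu).
  by field; rewrite !gt_eqF.
by rewrite ler_pdivlMr //; lra.
Qed.

End Bregman.

Lemma affine_recursion_le (R : realFieldType) (v q e : nat -> R) :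
  (forall k, 0 <= q k) ->
  (forall k, v k.+1 <= q k.+1 * v k + e k.+1) ->
  forall k, v k.+1 <= \prod_(1 <= m < k.+2) q m * v 0%N + e k.+1
    + \sum_(1 <= j < k.+1) (e j * \prod_(j.+1 <= m < k.+2) q m).
Proof.
move=> q0 vS; elim=> [|k IH].
  by rewrite big_nat1 [X in _ + X]big_geq // addr0 vS.
apply: le_trans (vS k.+1) _.
have /(ler_wpM2l (q0 k.+2)) := IH.
rewrite -(lerD2r (e k.+2)) => /le_trans; apply.
(* The previous newest error [e k.+1] becomes the last summand, contracted by the single factor
   [q k.+2]; every older product gains that same factor. *)
rewrite [X in _ <= X * _ + _ + _]big_nat_recr //= [X in _ <= _ + X]big_nat_recr //=.
rewrite big_nat1.
rewrite [X in _ <= _ + (X + _)](_ : _ = q k.+2 *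
    \sum_(1 <= j < k.+1) (e j * \prod_(j.+1 <= m < k.+2) q m)); last first.
  rewrite mulr_sumr; apply: eq_big_nat => j /andP[_ jk].
  by rewrite big_nat_recr /= 1?ltnW // mulrA mulrC.
lra.
Qed.

Theorem theorem3 (R : realType) (n : nat) (X : set 'rV[R]_n)
    (d : 'rV[R]_n -> R) (g : 'rV[R]_n -> 'rV[R]_n) (mu delta : R)
    (zstar : 'rV[R]_n)
    (i : nat -> nat) (L : nat -> R) (w z : nat -> 'rV[R]_n)
    (hXclosed : closed X)
    (hXconvex : @convex_set R 'rV[R]_n X)
    (hd : prox_function d)
    (hmu : 0 < mu)
    (hg : rel_strongly_monotone X d mu g)
    (hzstar : minty_solution X g zstar)
    (hdelta : 0 < delta)
    (hL0 : 0 < L 0%N)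
    (hrun : adaptive_run X d g mu delta i L w z) :
  forall k : nat,
    bregman d zstar (z k.+1) <=
      \prod_(1 <= m < k.+2) (1 + mu / L m)^-1 * bregman d zstar (z 0%N)
      + delta / (L k.+1 + mu)
      + \sum_(1 <= j < k.+1)
          (delta / (L j + mu)
           * \prod_(j.+1 <= m < k.+2) (1 + mu / L m)^-1).
Proof.
(* Each update multiplies by an integer power of 2, whose exponent may be -1, so positivity passes
   on from [L 0]. *)
have L0 k : 0 < L k.
  elim: k => // k Lk; rewrite (run_constant hrun) /trial_constant.
  by rewrite mulr_gt0 // exprz_gt0.
apply: (@affine_recursion_le R (fun k => bregman d zstar (z k))
  (fun k => (1 + mu / L k)^-1) (fun k => delta / (L k + mu))) => k.
  by rewrite invr_ge0 addr_ge0 // divr_ge0 // ltW.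
apply: adaptive_step hXconvex hd hmu (L0 _) hg hzstar _ _.
  exact: run_step hrun k.
exact: run_accept hrun k.
Qed.
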